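(* The order $\frac{p}{\ln(p+1)}$ of the constant in Rosenthal's inequality in $L_p$ is optimal when $p\to\infty$. Precisely: for $1\le p<\infty$ let $C_p$ be the least constant such that $$\Bigl\|\sum_{k=1}^nf_k\Bigr\|_{L_p}\le C_p\Bigl(\bigl\|F^*\chi_{[0,1]}\bigr\|_{L_p}+\bigl\|F^*\chi_{[1,\infty)}\bigr\|_{L_1}\Bigr)$$ for every $n\in\mathbb{N}$ and every sequence $\{f_k\}_{k=1}^n\subset L_p[0,1]$ of independent random variables, $F$ being the disjointification of $\{f_k\}_{k=1}^n$. Then there are universal constants $0<c\le\alpha<\infty$ such that $c\,\frac{p}{\ln(p+1)}\le C_p\le\alpha\,\frac{p}{\ln(p+1)}$ for all sufficiently large $p$.
   Context: Random variables are measurable functions on $[0,1]$ with Lebesgue measure. $f^*$ denotes the decreasing rearrangement of $|f|$. The disjointification of $\{f_k\}_{k=1}^n$ is $F=\sum_{k=1}^n\bar f_k$ on $(0,\infty)$, where the $\bar f_k$ have pairwise disjoint supports and $\bar f_k$ is equimeasurable with $f_k$ (e.g. $F(t)=\sum_{k=1}^n f_k(t-k+1)\chi_{[k-1,k]}(t)$). *)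

(* Defs.v *)
From HB Require Import structures.
From mathcomp Require Export all_boot all_order all_algebra.
From mathcomp Require Export all_classical all_reals all_analysis.

Set Implicit Arguments.
Unset Strict Implicit.
Unset Printing Implicit Defensive.

Export Order.TTheory GRing.Theory Num.Theory.
Export numFieldNormedType.Exports.

Local Open Scope classical_set_scope.
Local Open Scope ring_scope.

(* A random variable is represented by a function R -> R of which only the
   restriction to [0, 1] matters; g \_ D is g on D and 0 elsewhere, so that the
   L_p norm of g over D is 'N[lebesgue_measure]_p[g \_ D]. Measurability is with
   respect to Borel sets, the sigma-algebra carried by lebesgue_measure. *)
Definition Lp01 (R : realType) (p : R) (f : R -> R) : Prop :=
  f \_ `[0, 1] \in Lfun (@lebesgue_measure R) p%:E.

(* Taking A k := setT, whose factor is 1, gives the product rule for the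
   subfamilies. *)
Definition independent01 (R : realType) (n : nat) (f : 'I_n -> R -> R) : Prop :=
  forall A : 'I_n -> set R, (forall k, measurable (A k)) ->
    lebesgue_measure (`[0, 1] `&` \bigcap_k (f k @^-1` A k)) =
    (\prod_(k < n) lebesgue_measure (`[0%R, 1%R] `&` (f k @^-1` A k)))%E.

(* The value is +oo when no s qualifies. *)
Definition decreasing_rearrangement (R : realType) (D : set R) (f : R -> R)
    (t : R) : \bar R :=
  ereal_inf [set s%:E | s in [set s : R | 0 <= s /\
    (lebesgue_measure (D `&` [set x | (s < `|f x|)%R]) <= t%:E)%E]].

(* Half-open intervals make the supports of the summands pairwise disjoint. *)
Definition disjointification (R : realType) (n : nat) (f : 'I_n -> R -> R)
    (t : R) : R :=
  \sum_(k < n) f k (t - k%:R) * \1_(`[k%:R, k%:R + 1[ : set R) t.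

Definition rosenthal_admissible (R : realType) (p C : R) : Prop :=
  forall (n : nat) (f : 'I_n -> R -> R),
    (forall k, Lp01 p (f k)) -> independent01 f ->
    let Fstar := decreasing_rearrangement `]0, +oo[ (disjointification f) in
    ('N[lebesgue_measure]_(p%:E)
        [EFin \o ((fun x : R => (\sum_(k < n) f k x)%R) \_ `[0%R, 1%R])] <=
     C%:E * ('N[lebesgue_measure]_(p%:E) [Fstar \_ `[0%R, 1%R]] +
             'N[lebesgue_measure]_1 [Fstar \_ `[1%R, +oo[]))%E.

Definition is_rosenthal_constant (R : realType) (p C : R) : Prop :=
  rosenthal_admissible p C /\
  forall C' : R, rosenthal_admissible p C' -> C <= C'.

(* Main.v *)
Require Import Defs.
From mathcomp Require Import measurable_realfun ring lra.

(** The upper bound combines one pointwise inequality with independence.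
Write x = min(x, 1) max(x, 1). For nonnegative x_1, ..., x_n this gives
  x_1 + ... + x_n <= W * (max(x_1, 1) * ... * max(x_n, 1)),
where W is the sum of the min(x_k, 1), because every max(x_k, 1) is at most the
product of all of them. As W <= (p/a) e^(a W / p), the p-th power of the sum is
at most (p/a)^p times the product of the weights
  w(x_k) = e^(a min(x_k, 1)) max(x_k, 1)^p
([powR_sum_le_prod_exp_weight]). Take x_k = |f_k| / r, where r bounds both
norms of the rearrangement. By independence the expectation of the product of
the weights is at most the product of their expectations
([expectation_prod_le]), hence at most the exponential of the sum of the
E(w(x_k) - 1). That sum is the integral of w(|F| / r) - 1 for the
disjointification F ([integral_disjointification]), which is also the integral
of the same expression in the decreasing rearrangement, by equimeasurability
([integral_rearrangement]). On [0, 1] the excess w(x) - 1 is at most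
e^a (1 + x^p); beyond 1 the rearrangement is at most r and the excess is at
most (e^a - 1) x; so the integral is at most 3 e^a
([exp_weight_rearrangement_le]). The choice a = ln p gives
E|f_1 + ... + f_n|^p <= (r p / ln p)^p e^(3p), that is, the constant
e^3 p / ln p ([rosenthal_admissible_upper]).

For the lower bound, let f_1, ..., f_n be the indicators of n independent
events of probability 1/n. The disjointification is then the indicator of a set
of measure 1, so the right-hand side is at most the constant itself, while the
sum equals n with probability n^(-n). Hence the constant is at least
n n^(-n/p), and for n the integer part of p / ln p the factor n^(-n/p) is at
least 1/e ([rosenthal_admissible_lower]). The events are read off the n digits
in base n that code the n^n intervals of a subdivision of [0, 1].

Finally the set of admissible constants is nonempty, bounded below by a
positive number and closed, so it has a least element
([rosenthal_constant_exists]). *)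

Set Implicit Arguments.
Unset Strict Implicit.
Unset Printing Implicit Defensive.

Import HBNNSimple.

Local Open Scope classical_set_scope.
Local Open Scope ring_scope.

(** * Bounding powers of sums by products *)

(** The excess of this weight over 1 is linear in x near 0 and of order x^p at
infinity, which matches the two norms of the rearrangement. *)
Definition exp_weight (R : realType) (a p x : R) : R :=
  expR (a * Num.min x 1) * Num.max x 1 `^ p.

(** Each x is min(x, 1) max(x, 1), and a factor of a product of numbers that are
at least 1 is at most the whole product. *)
Lemma sum_le_prod_max_sum_min (R : realType) (n : nat) (x : 'I_n -> R) :
  (forall k, 0 <= x k) ->
  \sum_(k < n) x k <=
  (\prod_(k < n) Num.max (x k) 1) * \sum_(k < n) Num.min (x k) 1.
Proof.
move=> x0; rewrite mulr_sumr; apply: ler_sum => k _.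
have min0 : 0 <= Num.min (x k) 1 by rewrite le_min x0 ler01.
rewrite -{1}[x k]mul1r.
have -> : 1 * x k = Num.max (x k) 1 * Num.min (x k) 1.
  by rewrite mul1r; case: (leP (x k) 1) => _; rewrite ?mul1r ?mulr1.
apply: ler_wpM2r => //; rewrite (bigD1 k)//=.
rewrite ler_peMr// ?le_max ?ler01 ?orbT//.
elim/big_ind: _ => // [y z|i _]; first exact: mulr_ege1.
by rewrite le_max lexx orbT.
Qed.

Lemma powR_prod (R : realType) (I : Type) (s : seq I) (P : pred I) (p : R)
    (F : I -> R) : (forall i, P i -> 0 <= F i) ->
  (\prod_(i <- s | P i) F i) `^ p = \prod_(i <- s | P i) (F i `^ p).
Proof.
move=> F0; suff [] : (\prod_(i <- s | P i) F i) `^ p =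
   \prod_(i <- s | P i) (F i `^ p) /\ 0 <= \prod_(i <- s | P i) F i by [].
elim/big_ind2: _ => [|x1 x2 y1 y2 [xx x0] [yy y0]|i Pi].
- by rewrite powR1.
- by split; [|exact: mulr_ge0]; rewrite powRM// xx yy.
- by split => //; exact: F0.
Qed.

(** With W the sum of the min(x_k, 1), the inequality t <= e^t at t = a W / p
gives W^p <= (p/a)^p e^(a W), and e^(a W) is a product over k. The point is
that the right-hand side is multiplicative, so that independence applies to
it. *)
Lemma powR_sum_le_prod_exp_weight (R : realType) (a p : R) (n : nat)
    (x : 'I_n -> R) : 0 < a -> 0 < p -> (forall k, 0 <= x k) ->
  (\sum_(k < n) x k) `^ p <= (p / a) `^ p * \prod_(k < n) exp_weight a p (x k).
Proof.
move=> a0 p0 x0.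
have max0 k : 0 <= Num.max (x k) 1 by rewrite le_max ler01 orbT.
set M := \prod_(k < n) Num.max (x k) 1.
set W := \sum_(k < n) Num.min (x k) 1.
have M0 : 0 <= M by apply: prodr_ge0.
have W0 : 0 <= W by apply: sumr_ge0 => k _; rewrite le_min x0 ler01.
have pa0 : 0 < p / a by rewrite divr_gt0.
have WE : W <= p / a * expR (a * W / p).
  have : a * W / p <= expR (a * W / p).
    by apply: le_trans (expR_ge1Dx _); rewrite lerDr ler01.
  move/(ler_wpM2l (ltW pa0)); apply: le_trans.
  by rewrite le_eqVlt; apply/orP; left; apply/eqP; field; rewrite !gt_eqF.
have SW : \sum_(k < n) x k <= M * (p / a * expR (a * W / p)).
  by apply: le_trans (sum_le_prod_max_sum_min x0) _; exact: ler_wpM2l.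
have E0 : 0 <= p / a * expR (a * W / p) by rewrite mulr_ge0 ?expR_ge0 ?ltW.
apply: le_trans (ge0_ler_powR (ltW p0) _ _ SW) _; rewrite ?nnegrE.
- by apply: sumr_ge0.
- by apply: mulr_ge0.
rewrite (powRM p M0 E0) (powRM p (ltW pa0) (expR_ge0 _)).
have -> : expR (a * W / p) `^ p = \prod_(k < n) expR (a * Num.min (x k) 1).
  rewrite -expRM mulfVK ?gt_eqF// -expR_sum; congr expR.
  by rewrite /W mulr_sumr.
rewrite powR_prod// mulrCA -big_split/=.
apply: ler_wpM2l; first exact: powR_ge0.
by apply: ler_prod => k _; rewrite mulr_ge0 ?expR_ge0 ?powR_ge0 //= mulrC.
Qed.

Lemma exp_weight_ge1 (R : realType) (a p x : R) : 0 <= a -> 0 <= p -> 0 <= x ->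
  1 <= exp_weight a p x.
Proof.
move=> a0 p0 x0; rewrite /exp_weight -[leLHS]mulr1 ler_pM//.
- by rewrite -[leLHS]expR0 ler_expR mulr_ge0// le_min x0 ler01.
- have m1 : 1 <= Num.max x 1 by rewrite le_max lexx orbT.
  apply: (@le_trans _ _ (1 `^ p)); first by rewrite powR1.
  by apply: ge0_ler_powR => //; rewrite nnegrE ?ler01// (le_trans ler01 m1).
Qed.

Lemma expR_chord (R : realType) (a x : R) : 0 <= x <= 1 ->
  expR (a * x) <= 1 + (expR a - 1) * x.
Proof.
move=> /andP[x0 x1].
have /= := @convex_expR R (Itv01 x0 x1) a 0.
rewrite !convRE /= !expR0 !mulr0 !addr0 mulr1 (mulrC x) => /le_trans; apply.
by rewrite (_ : _ + _ = x * expR a + (1 - x))//; lra.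
Qed.

Lemma exp_weight_sub1_small (R : realType) (a p x : R) : 0 <= x <= 1 ->
  exp_weight a p x - 1 <= (expR a - 1) * x.
Proof.
move=> x01; have /andP[x0 x1] := x01.
rewrite /exp_weight (min_idPl x1) (max_idPr x1) powR1 mulr1 lerBlDl.
exact: expR_chord.
Qed.

Lemma exp_weight_sub1_large (R : realType) (a p x : R) :
  0 <= a -> 0 <= p -> 0 <= x ->
  exp_weight a p x - 1 <= expR a * (1 + x `^ p).
Proof.
move=> a0 p0 x0; rewrite lerBlDr; apply: ler_wpDr => //.
rewrite /exp_weight ler_pM ?expR_ge0 ?powR_ge0//.
- by rewrite ler_expR -[leRHS]mulr1 ler_wpM2l// ge_min lexx orbT.
- case: (leP x 1) => _; first by rewrite powR1 lerDl powR_ge0.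
  by rewrite lerDr ler01.
Qed.

Lemma measurable_exp_weight (R : realType) (a p : R) :
  measurable_fun setT (exp_weight a p).
Proof.
apply: measurable_funM.
- apply: measurableT_comp => //; apply: measurable_funM => //.
  exact: measurable_minr.
- apply: (measurableT_comp (measurable_powR p)).
  exact: measurable_maxr.
Qed.

(** * Expectations of products of independent variables *)

Lemma indic_bigcap (R : realType) (T : Type) (n : nat) (B : 'I_n -> set T) (x : T) :
  \prod_(k < n) \1_(B k) x = \1_(\bigcap_k B k) x :> R.
Proof.
have [Bx|Bx] := pselect ((\bigcap_k B k) x).
  rewrite [RHS]indicE mem_set//= big1// => k _.
  by rewrite indicE mem_set//; exact: Bx.
rewrite [RHS]indicE memNset//=.
have /existsNP[k Bkx] : ~ forall k, B k x by move=> H; apply: Bx => k _.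
by rewrite (bigD1 k)//= indicE memNset// mul0r.
Qed.

Lemma integral_weighted_indic (d : measure_display) (T : measurableType d) (R : realType)
    (mu : {measure set T -> \bar R}) (D : set T) (I : finType)
    (c : I -> R) (B : I -> set T) :
  measurable D -> (mu D < +oo)%E -> (forall i, 0 <= c i) ->
  (forall i, measurable (D `&` B i)) ->
  (\int[mu]_(x in D) (\sum_i c i * \1_(B i) x)%:E =
   (\sum_i c i * fine (mu (D `&` B i)))%:E)%E.
Proof.
move=> mD muD c0 mB.
have finB i : mu (D `&` B i) \is a fin_num.
  rewrite ge0_fin_numE//; apply: le_lt_trans muD.
  by apply: le_measure; rewrite ?inE//; exact: subIsetl.
transitivity (\int[mu]_(x in D) \sum_i ((c i)%:E * (\1_(D `&` B i) x)%:E))%E.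
  apply: eq_integral => x; rewrite inE => Dx.
  rewrite -sumEFin; apply: eq_bigr => i _; rewrite EFinM; congr (_ * _%:E)%E.
  by rewrite !indicE in_setI (mem_set Dx).
have mind i : measurable_fun D (fun x => (\1_(D `&` B i) x)%:E : \bar R).
  by apply/measurable_EFinP; exact: measurable_indic.
rewrite ge0_integral_sum//; last 2 first.
- by move=> i; exact: measurable_funeM.
- by move=> i x _; rewrite mule_ge0// lee_fin// indicE.
rewrite -sumEFin; apply: eq_bigr => i _.
rewrite ge0_integralZl_EFin//.
by rewrite integral_indic// EFinM fineK// setIAC setIid.
Qed.

(** A simple function is a finite combination of indicators. Expanding the product
of these combinations over all choices of one value per factor leaves measures
of intersections, to which the product rule applies. *)
Lemma expectation_prod_nnsfun (d : measure_display) (T : measurableType d)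
    (R : realType) (mu : {measure set T -> \bar R}) (D : set T) (n : nat)
    (f : 'I_n -> T -> R) (phi : {nnsfun R >-> R}) :
  measurable D -> (mu D < +oo)%E ->
  (forall k, measurable_fun D (f k)) ->
  (forall A : 'I_n -> set R, (forall k, measurable (A k)) ->
    mu (D `&` \bigcap_k (f k @^-1` A k)) =
    (\prod_(k < n) mu (D `&` (f k @^-1` A k)))%E) ->
  (\int[mu]_(x in D) (\prod_(k < n) phi (f k x))%:E =
   \prod_(k < n) \int[mu]_(x in D) (phi (f k x))%:E)%E.
Proof.
move=> mD muD mf ind.
pose r := finmap.enum_fset (fset_set (range phi)).
pose N := size r; pose c (j : 'I_N) := r`_j; pose B j := phi @^-1` [set c j].
have phi_sum y : phi y = \sum_(j < N) c j * \1_(B j) y := fimfunEord phi y.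
have c0 j : 0 <= c j.
  have : c j \in r by exact: mem_nth.
  by rewrite in_fset_set// inE => -[y _ <-].
have mB j : measurable (B j) by exact: measurable_funPTI.
have mfB k j : measurable (D `&` f k @^-1` B j) by exact: mf.
have phiE k : (\int[mu]_(x in D) (phi (f k x))%:E =
   (\sum_(j < N) c j * fine (mu (D `&` f k @^-1` B j)))%:E)%E.
  rewrite -integral_weighted_indic//.
  by apply: eq_integral => x _; rewrite phi_sum.
under eq_bigr do rewrite phiE.
rewrite prodEFin bigA_distr_bigA/=.
transitivity (\int[mu]_(x in D) (\sum_(s : {ffun 'I_n -> 'I_N})
   (\prod_(k < n) c (s k)) * \1_(\bigcap_k (f k @^-1` B (s k))) x)%:E)%E.
  apply: eq_integral => x _; congr EFin.
  under eq_bigr do rewrite phi_sum.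
  rewrite bigA_distr_bigA/=; apply: eq_bigr => s _.
  by rewrite big_split/= -indic_bigcap.
rewrite integral_weighted_indic//; last 2 first.
- by move=> s; exact: prodr_ge0.
- move=> s; rewrite (_ : _ `&` _ =
      D `&` \bigcap_k (D `&` f k @^-1` B (s k))); last first.
    apply/seteqP; split=> x [Dx fx]; split=> // k _; have := fx k I; first by [].
    by case.
  apply: measurableI => //; apply: fin_bigcap_measurable => // k _; exact: mfB.
have finB k j : mu (D `&` f k @^-1` B j) \is a fin_num.
  rewrite ge0_fin_numE//; apply: le_lt_trans muD.
  by apply: le_measure; rewrite ?inE//; exact: subIsetl.
congr EFin; apply: eq_bigr => s _.
rewrite (ind (B \o s)); last by move=> k; exact: mB.
rewrite [RHS]big_split/=; congr (_ * _); apply: EFin_inj.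
rewrite fineK ?prode_fin_num// -prodEFin; apply: eq_bigr => k _.
by rewrite fineK.
Qed.

Lemma lee_prod (R : realType) (I : Type) (s : seq I) (P : pred I)
    (F G : I -> \bar R) : (forall i, P i -> 0 <= F i <= G i)%E ->
  (\prod_(i <- s | P i) F i <= \prod_(i <- s | P i) G i)%E.
Proof.
move=> FG; suff /andP[] : (0 <= \prod_(i <- s | P i) F i <=
  \prod_(i <- s | P i) G i)%E by [].
elim/big_ind2: _ => [|x1 x2 y1 y2 /andP[x0 xx] /andP[y0 yy]|i Pi].
- by rewrite lexx lee_fin ler01.
- by rewrite mule_ge0//= lee_pmul.
- exact: FG.
Qed.

(** The function phi is the increasing limit of simple functions, hence so is the
product in the integrand; the integrals of the simple approximants factor, and
each factor is at most the corresponding integral of phi. *)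
Lemma expectation_prod_le (d : measure_display) (T : measurableType d) (R : realType)
    (mu : {measure set T -> \bar R}) (D : set T) (n : nat) (f : 'I_n -> T -> R)
    (phi : R -> R) :
  measurable D -> (mu D < +oo)%E ->
  (forall k, measurable_fun D (f k)) ->
  (forall A : 'I_n -> set R, (forall k, measurable (A k)) ->
    mu (D `&` \bigcap_k (f k @^-1` A k)) =
    (\prod_(k < n) mu (D `&` (f k @^-1` A k)))%E) ->
  measurable_fun setT phi -> (forall y, 0 <= phi y) ->
  (\int[mu]_(x in D) (\prod_(k < n) phi (f k x))%:E <=
   \prod_(k < n) \int[mu]_(x in D) (phi (f k x))%:E)%E.
Proof.
move=> mD muD mf ind mphi phi0.
have mphiE : measurable_fun setT (EFin \o phi) by exact/measurable_EFinP.
pose s := nnsfun_approx measurableT mphiE.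
have scvg y : s m y @[m --> \oo] --> phi y.
  have /fine_cvgP[_] := @cvg_nnsfun_approx _ _ _ _ measurableT _ mphiE
    (fun y _ => phi0 y) y I.
  by [].
have sle m y : s m y <= phi y.
  rewrite -lee_fin /s nnsfun_approxE; apply: (@le_approx _ _ _ setT (EFin \o phi)) => //.
  by move=> ? _; rewrite lee_fin.
have snd y : {homo (fun m => s m y) : m1 m2 / (m1 <= m2)%N >-> m1 <= m2}.
  by move=> m1 m2 m12; exact/lefP/nd_nnsfun_approx.
have s0 m y : 0 <= s m y by [].
have mcomp (g : R -> R) k : measurable_fun setT g ->
    measurable_fun D (fun x => g (f k x)).
  by move=> mg; exact: (measurableT_comp mg).
have -> : (\int[mu]_(x in D) (\prod_(k < n) phi (f k x))%:E =
    \int[mu]_(x in D) limn (fun m => (\prod_(k < n) s m (f k x))%:E))%E.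
  apply: eq_integral => x _; apply/esym/cvg_lim => //.
  apply: cvg_EFin; first exact: nearW.
  apply: (@cvg_big _ _ _ _ xpredT) => // ; exact: mul_continuous.
rewrite monotone_convergence//; first last.
- by move=> x Dx m1 m2 m12; rewrite lee_fin; apply: ler_prod => k _; rewrite s0 snd.
- by move=> m x _; rewrite lee_fin; apply: prodr_ge0.
- move=> m; apply/measurable_EFinP; apply: measurable_prod => k _.
  by apply: mcomp; exact: measurable_funP.
apply: lime_le.
  apply: ereal_nondecreasing_is_cvgn => m1 m2 m12; apply: ge0_le_integral => //.
  - by move=> x _; rewrite lee_fin; apply: prodr_ge0.
  - apply/measurable_EFinP; apply: measurable_prod => k _.
    by apply: mcomp; exact: measurable_funP.
  - apply/measurable_EFinP; apply: measurable_prod => k _.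
    by apply: mcomp; exact: measurable_funP.
  - by move=> x Dx; rewrite lee_fin; apply: ler_prod => k _; rewrite s0 snd.
apply: nearW => m.
rewrite expectation_prod_nnsfun//.
apply: lee_prod => k _; apply/andP; split.
  by apply: integral_ge0 => x _; rewrite lee_fin.
apply: ge0_le_integral => //.
- by move=> x _; rewrite lee_fin.
- apply/measurable_EFinP; apply: mcomp; exact: measurable_funP.
- apply/measurable_EFinP; exact: mcomp.
- by move=> x _; rewrite lee_fin.
Qed.

(** * Decreasing rearrangements *)

(** The distribution function, of which the decreasing rearrangement is the
generalized inverse. *)
Definition tail_measure (R : realType) (D : set R) (f : R -> R) (s : R) : \bar R :=
  lebesgue_measure (D `&` [set x | s < `|f x|]).

Section rearrangement.
Variables (R : realType) (D : set R) (f : R -> R).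
Hypothesis (mD : measurable D) (mf : measurable_fun D f).

Lemma measurable_superlevel (s : R) : measurable (D `&` [set x | s < `|f x|]).
Proof.
rewrite (_ : [set x | s < `|f x|] = (@Num.norm R R \o f) @^-1` `]s, +oo[).
  by apply: (measurableT_comp _ mf) => //; exact: measurable_itv.
by apply/seteqP; split=> x /=; rewrite in_itv/= andbT.
Qed.

Lemma tail_nonincreasing (s t : R) : s <= t ->
  (tail_measure D f t <= tail_measure D f s)%E.
Proof.
move=> st; apply: le_measure; rewrite ?inE; try exact: measurable_superlevel.
by move=> x [Dx /= fx]; split => //=; exact: le_lt_trans st fx.
Qed.

(** Right continuity of the tail: the level set at s is the increasing union of
the level sets at s + 1/(i+1), so continuity of the measure from below
applies. *)
Lemma tail_right_approx (s : R) (y : \bar R) : (y < tail_measure D f s)%E ->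
  exists2 s', s < s' & (y < tail_measure D f s')%E.
Proof.
pose S n := D `&` [set x | s + n.+1%:R^-1 < `|f x|].
have SE : D `&` [set x | s < `|f x|] = \bigcup_n S n.
  apply/seteqP; split=> x [].
    move=> Dx /= sf; have := sf; rewrite -subr_gt0 => /ltr_add_invr[n].
    by rewrite add0r ltrBrDl => nf; exists n.
  by move=> n _ [Dx /= sf]; split => //=; apply: lt_trans sf; rewrite ltrDl invr_gt0.
have Scvg : lebesgue_measure \o S @ \oo --> tail_measure D f s.
  rewrite /tail_measure SE; apply: nondecreasing_cvg_mu.
  - by move=> n; exact: measurable_superlevel.
  - by apply: bigcup_measurable => n _; exact: measurable_superlevel.
  - move=> m n mn; apply/subsetPset => x [Dx /= fx]; split => //=.
    by apply: le_lt_trans fx; rewrite lerD2l lef_pV2 ?posrE// ler_nat.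
move=> ys.
have [n _ /(_ n (leqnn n)) /= yn] :
    \forall n \near \oo, (y < (lebesgue_measure \o S) n)%E.
  apply: (Scvg [set z | y < z]%E); apply: open_nbhs_nbhs.
  by split => //; exact: open_ereal_gt_ereal.
by exists (s + n.+1%:R^-1) => //; rewrite ltrDl invr_gt0.
Qed.

Lemma rearrangement_ge0 (t : R) : (0 <= decreasing_rearrangement D f t)%E.
Proof. by apply: le_ereal_inf_tmp => _ [s [s0 _] <-]; rewrite lee_fin. Qed.

Lemma rearrangement_le (s t : R) : 0 <= s -> (tail_measure D f s <= t%:E)%E ->
  (decreasing_rearrangement D f t <= s%:E)%E.
Proof. by move=> s0 st; apply: ereal_inf_lbound; exists s. Qed.

Lemma rearrangement_nonincreasing (s t : R) : s <= t ->
  (decreasing_rearrangement D f t <= decreasing_rearrangement D f s)%E.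
Proof.
move=> st; apply: ereal_inf_le_tmp => _ [x [x0 xs] <-]; exists x => //; split=> //.
by apply: le_trans xs _; rewrite lee_fin.
Qed.

(** Right continuity of the tail makes the tail and the rearrangement generalized
inverses of each other. In particular the level sets of the rearrangement are
half-lines, whose positive parts have the same measure as the level sets of
f. *)
Lemma lt_rearrangement (s t : R) : 0 <= s ->
  (s%:E < decreasing_rearrangement D f t)%E = (t%:E < tail_measure D f s)%E.
Proof.
move=> s0; apply/idP/idP => [|ts].
  by apply: contraTT; rewrite -!leNgt; exact: rearrangement_le.
have [s' ss' ts'] := tail_right_approx ts.
apply: (@lt_le_trans _ _ s'%:E); first by rewrite lte_fin.
apply: le_ereal_inf_tmp => _ [x [x0 xt] <-]; rewrite lee_fin leNgt; apply/negP => xs'.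
have := lt_le_trans ts' (tail_nonincreasing (ltW xs')).
by rewrite ltNge xt.
Qed.

Lemma measurable_rearrangement :
  measurable_fun setT (decreasing_rearrangement D f).
Proof.
move=> _; apply: (measurability _ (ErealGenOInfty.measurableE R)) => //.
move=> /= _ [_ [s ->] <-]; rewrite setTI.
have [s0|s0] := leP 0 s.
  rewrite (_ : _ @^-1` _ = EFin @^-1` `]-oo, tail_measure D f s[%classic).
    rewrite -[X in measurable X]setTI; apply: EFin_measurable => //.
    exact: emeasurable_itv.
  by apply/seteqP; split => t /=; rewrite !in_itv/= ?andbT lt_rearrangement.
rewrite (_ : _ @^-1` _ = setT)//; apply/seteqP; split => t //= _.
by rewrite in_itv/= andbT; apply: lt_le_trans (rearrangement_ge0 t); rewrite lte_fin.
Qed.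

Hypothesis tail_fin : (tail_measure D f 0 < +oo)%E.

(** The level sets at integer heights decrease to the empty set, and they have
finite measure, so that some height has a tail of at most t. *)
Lemma rearrangement_lty (t : R) : 0 < t ->
  (decreasing_rearrangement D f t < +oo)%E.
Proof.
move=> t0; pose S n := D `&` [set x | n%:R < `|f x|].
have S0 : \bigcap_n S n = set0.
  rewrite -subset0 => x Sx; have [_ /=] := Sx (Num.truncn `|f x|).+1 I.
  by rewrite ltNge ltW// truncnS_gt.
have Scvg : lebesgue_measure \o S @ \oo --> lebesgue_measure (\bigcap_n S n).
  apply: nonincreasing_cvg_mu.
  - exact: tail_fin.
  - by move=> n; exact: measurable_superlevel.
  - by rewrite S0.
  - move=> m n mn; apply/subsetPset => x [Dx /= fx]; split => //=.
    by apply: le_lt_trans fx; rewrite ler_nat.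
have [n _ /(_ n (leqnn n)) /= yn] :
    \forall n \near \oo, ((lebesgue_measure \o S) n < t%:E)%E.
  apply: (Scvg [set z | z < t%:E]%E); apply: open_nbhs_nbhs.
  by split; [exact: open_ereal_lt_ereal|rewrite /= S0 measure0 lte_fin].
apply: (@le_lt_trans _ _ n%:R%:E); last exact: ltry.
by apply: rearrangement_le => //; exact: ltW.
Qed.

End rearrangement.

(** Rays generate the Borel sets and are stable under intersection, so the two
image measures, restricted to positive values, coincide as soon as they agree
on rays. The value 0 is left out because the functions may take it on a set of
infinite measure. *)
Lemma eq_pushforward_rays (d1 d2 : measure_display) (T1 : measurableType d1)
    (T2 : measurableType d2) (R : realType) (mu1 : {measure set T1 -> \bar R})
    (mu2 : {measure set T2 -> \bar R}) (f : T1 -> R) (g : T2 -> R) :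
  measurable_fun setT f -> measurable_fun setT g ->
  (forall s, 0 <= s -> mu1 (f @^-1` `]s, +oo[) = mu2 (g @^-1` `]s, +oo[)) ->
  (mu1 (f @^-1` `]0%R, +oo[) < +oo)%E ->
  forall A : set R, measurable A -> A `<=` `]0, +oo[ ->
  mu1 (f @^-1` A) = mu2 (g @^-1` A).
Proof.
move=> mf mg fg ffin A mA A0.
have mpos : measurable (`]0, +oo[%classic : set R) by exact: measurable_itv.
pose nu1 : {measure set R -> \bar R} := mrestr (pushforward mu1 f) mpos.
pose nu2 : {measure set R -> \bar R} := mrestr (pushforward mu2 g) mpos.
have -> : mu1 (f @^-1` A) = nu1 mf A.
  by rewrite /nu1/= /mrestr /pushforward; congr (mu1 (f @^-1` _)); apply/esym/setIidl.
have -> : mu2 (g @^-1` A) = nu2 mg A.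
  by rewrite /nu2/= /mrestr /pushforward; congr (mu2 (g @^-1` _)); apply/esym/setIidl.
have rayI (s t : R) : `]s, +oo[%classic `&` `]t, +oo[%classic =
    `]Num.max s t, +oo[%classic.
  by apply/seteqP; split => x /=; rewrite !in_itv/= !andbT gt_max => /andP.
apply: (measure_unique (@RGenOInfty.G R) (fun n => `](- n%:R), +oo[%classic)) => //.
- exact: RGenOInfty.measurableE.
- by move=> _ _ [s ->] [t ->]; exists (Num.max s t).
- by move=> n; eexists.
- apply/seteqP; split => // x _; exists (Num.truncn `|x|).+1 => //=.
  rewrite in_itv/= andbT ltrNl; apply: le_lt_trans (truncnS_gt _).
  by rewrite -normrN ler_norm.
- move=> _ [s ->]; rewrite /nu1/= /nu2/= /mrestr /pushforward !rayI; apply: fg.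
  by rewrite le_max lexx orbT.
- move=> n; rewrite /nu1/= /mrestr /pushforward rayI max_r// oppr_le0.
Qed.

Lemma ge0_integral_eq_rays (d1 d2 : measure_display) (T1 : measurableType d1)
    (T2 : measurableType d2) (R : realType) (mu1 : {measure set T1 -> \bar R})
    (mu2 : {measure set T2 -> \bar R}) (f : T1 -> R) (g : T2 -> R) (Psi : R -> R) :
  measurable_fun setT f -> measurable_fun setT g ->
  (forall s, 0 <= s -> mu1 (f @^-1` `]s, +oo[) = mu2 (g @^-1` `]s, +oo[)) ->
  (mu1 (f @^-1` `]0%R, +oo[) < +oo)%E ->
  measurable_fun setT Psi -> (forall y, 0 < y -> 0 <= Psi y) ->
  (\int[mu1]_(x in f @^-1` `]0%R, +oo[) (Psi (f x))%:E =
   \int[mu2]_(x in g @^-1` `]0%R, +oo[) (Psi (g x))%:E)%E.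
Proof.
move=> mf mg fg ffin mPsi Psi0.
have mpos : measurable (`]0, +oo[%classic : set R) by exact: measurable_itv.
have mPsiE : measurable_fun (`]0, +oo[%classic : set R) (EFin \o Psi).
  by apply/measurable_EFinP; exact: measurable_funTS.
have PsiE0 : {in (`]0, +oo[%classic : set R), forall y, (0 <= (EFin \o Psi) y)%E}.
  by move=> y; rewrite inE/= in_itv/= andbT lee_fin; exact: Psi0.
have := ge0_integral_pushforward mf mu1 mpos mPsiE PsiE0.
have := ge0_integral_pushforward mg mu2 mpos mPsiE PsiE0.
rewrite /= => <- <-.
apply: eq_measure_integral => A mA A0; exact: (eq_pushforward_rays mf mg).
Qed.

(** The function and its rearrangement are equimeasurable by [lt_rearrangement].
Since Psi vanishes at 0, their zero sets contribute nothing to the integrals,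
and only the positive values have to be compared. *)
Lemma integral_rearrangement (R : realType) (D : set R) (f : R -> R)
    (Psi : R -> R) :
  measurable D -> measurable_fun D f -> (tail_measure D f 0 < +oo)%E ->
  measurable_fun setT Psi -> Psi 0 = 0 -> (forall y, 0 < y -> 0 <= Psi y) ->
  (\int[lebesgue_measure]_(x in D) (Psi `|f x|)%:E =
   \int[lebesgue_measure]_(t in `]0%R, +oo[)
     (Psi (fine (decreasing_rearrangement D f t)))%:E)%E.
Proof.
move=> mD mf tail_fin mPsi Psi00 Psi0.
set Fs := decreasing_rearrangement D f.
pose f1 : R -> R := (fun x => `|f x|) \_ D.
pose g : R -> R := (fine \o Fs) \_ `]0, +oo[.
have mpos : measurable (`]0, +oo[%classic : set R) by exact: measurable_itv.
have mf1 : measurable_fun setT f1.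
  apply/(measurable_restrictT _ mD).
  exact: (measurableT_comp (@normr_measurable R setT) mf).
have mg : measurable_fun setT g.
  apply/(measurable_restrictT _ mpos); apply: measurable_funTS.
  exact: (measurableT_comp (@fine_measurable R setT measurableT)
    (measurable_rearrangement mD mf)).
have f1E s : 0 <= s -> f1 @^-1` `]s, +oo[ = D `&` [set x | s < `|f x|].
  move=> s0; apply/seteqP; split => x; rewrite /f1 /= patchE in_itv/= andbT.
    by case: ifPn; rewrite ?inE// => _; rewrite ltNge s0.
  by move=> [Dx sf]; rewrite mem_set.
have tailE s : 0 <= s -> tail_measure D f s = (fine (tail_measure D f s))%:E.
  move=> s0; rewrite fineK// ge0_fin_numE; last exact: measure_ge0.
  exact: le_lt_trans (tail_nonincreasing mD mf s0) tail_fin.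
have gE s : 0 <= s -> g @^-1` `]s, +oo[ = `]0, fine (tail_measure D f s)[%classic.
  move=> s0; apply/seteqP; split => t; rewrite /g /= patchE !in_itv/= andbT.
    case: ifPn => [|_]; last by rewrite ltNge s0.
    rewrite inE/= in_itv/= andbT => t0 st; rewrite t0/= -lte_fin -tailE//.
    rewrite -lt_rearrangement// -[ltRHS]fineK ?lte_fin//.
    by rewrite ge0_fin_numE ?rearrangement_ge0//; exact: rearrangement_lty.
  move=> /andP[t0 tt]; rewrite mem_set/= ?in_itv/= ?t0//.
  rewrite -lte_fin fineK; last first.
    by rewrite ge0_fin_numE ?rearrangement_ge0//; exact: rearrangement_lty.
  by rewrite lt_rearrangement// tailE// lte_fin.
have fg s : 0 <= s -> lebesgue_measure (f1 @^-1` `]s, +oo[) =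
    lebesgue_measure (g @^-1` `]s, +oo[).
  move=> s0; rewrite f1E// gE// -/(tail_measure D f s) tailE// lebesgue_measure_itv/=.
  rewrite lte_fin; case: ltP => h; first by rewrite sube0.
  by congr EFin; apply/eqP; rewrite eq_le h fine_ge0// measure_ge0.
have f1_fin : (lebesgue_measure (f1 @^-1` `]0%R, +oo[) < +oo)%E by rewrite f1E.
have restrE (h : R -> R) (E : set R) : (forall x, E x -> 0 <= h x) ->
    (fun x => (Psi ((h \_ E) x))%:E) \_ ((h \_ E) @^-1` `]0, +oo[) =
    (fun x => (Psi (h x))%:E) \_ E.
  move=> h0; apply/funext => x; rewrite !patchE.
  have [Ex|Ex] := pselect (E x); last first.
    rewrite [in RHS]memNset// memNset//= patchE memNset//=.
    by rewrite in_itv/= ltxx.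
  rewrite (mem_set Ex); have := h0 _ Ex; rewrite le_eqVlt => /predU1P[hx|hx].
    by rewrite -hx Psi00 if_same.
  by rewrite mem_set//= patchE mem_set//= in_itv/= hx.
transitivity (\int[lebesgue_measure]_(x in f1 @^-1` `]0%R, +oo[) (Psi (f1 x))%:E)%E.
  by rewrite integral_mkcond [RHS]integral_mkcond /f1 restrE.
rewrite (@ge0_integral_eq_rays _ _ _ _ R lebesgue_measure lebesgue_measure
  f1 g Psi mf1 mg fg f1_fin mPsi Psi0).
rewrite integral_mkcond [RHS]integral_mkcond /g restrE// => t _.
exact/fine_ge0/rearrangement_ge0.
Qed.

Lemma lee_poweR (R : realType) (p : R) (x y : \bar R) : 0 <= p ->
  (0 <= x)%E -> (x <= y)%E -> (x `^ p <= y `^ p)%E.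
Proof.
move=> p0 x0 xy; have y0 := le_trans x0 xy.
by apply: gt0_ler_poweR => //; rewrite in_itv/= leey andbT.
Qed.

Lemma integral_poweR_le_of_Lnorm (R : realType) (E : set R) (h : R -> \bar R) (p r : R) :
  0 < p -> 0 <= r -> (forall t, 0 <= h t)%E ->
  ('N[lebesgue_measure]_(p%:E) [h \_ E] <= r%:E)%E ->
  (\int[lebesgue_measure]_(t in E) (h t `^ p) <= (r `^ p)%:E)%E.
Proof.
move=> p0 r0 h0 hr.
have := lee_poweR (ltW p0) (Lnorm_ge0 _ _ _) hr.
rewrite powR_Lnorm ?gt_eqF// poweR_EFin; apply: le_trans.
rewrite le_eqVlt; apply/orP; left; apply/eqP; rewrite [LHS]integral_mkcond.
apply: eq_integral => t _; rewrite !patchE; case: ifPn => _.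
  by rewrite gee0_abs.
by rewrite abse0 poweR0r ?gt_eqF.
Qed.

Lemma lebesgue_measure_unit (R : realType) :
  lebesgue_measure (`[0%R, 1%R]%classic : set R) = 1%:E :> \bar R.
Proof. by rewrite lebesgue_measure_itv/= lte_fin ltr01 sube0. Qed.

Section bound.
Variables (R : realType) (D : set R) (f : R -> R) (a p r : R).
Hypothesis (mD : measurable D) (mf : measurable_fun D f).
Hypothesis tail_fin : (tail_measure D f 0 < +oo)%E.
Hypothesis (a0 : 0 <= a) (p0 : 0 < p) (r0 : 0 < r).
Let Fs := decreasing_rearrangement D f.
Hypothesis headE : ('N[lebesgue_measure]_(p%:E) [Fs \_ `[0%R, 1%R]] <= r%:E)%E.
Hypothesis tailE : ('N[lebesgue_measure]_1 [Fs \_ `[1%R, +oo[] <= r%:E)%E.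

Let Fs0 t : (0 <= Fs t)%E. Proof. exact: rearrangement_ge0. Qed.

Let mFs E : measurable_fun E Fs.
Proof. by apply: measurable_funTS; exact: measurable_rearrangement. Qed.

Let mFsp (E : set R) : measurable_fun E (fun t => Fs t `^ p)%E.
Proof. exact: (measurableT_comp (measurable_poweR p) (mFs (E := E))). Qed.

Let head_le :
  (\int[lebesgue_measure]_(t in `[0%R, 1%R]) (Fs t `^ p) <= (r `^ p)%:E)%E.
Proof. by apply: integral_poweR_le_of_Lnorm => //; exact: ltW. Qed.

Let Fs1_le : (Fs 1 <= r%:E)%E.
Proof.
have : (Fs 1 `^ p <= (r `^ p)%:E)%E.
  apply: le_trans head_le.
  rewrite -[leLHS]mule1 -(lebesgue_measure_unit R) -integral_cst//.
  apply: ge0_le_integral => //=.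
  - by move=> t _; exact: poweR_ge0.
  - exact: mFsp.
  - move=> t /=; rewrite in_itv/= => /andP[_ t1].
    apply: lee_poweR (ltW p0) _ _ => //; exact: rearrangement_nonincreasing.
have pV0 : 0 <= p^-1 by rewrite invr_ge0 ltW.
move=> /(lee_poweR pV0 (poweR_ge0 _ _)).
rewrite -poweRrM -poweR_EFin -poweRrM divff ?gt_eqF//.
by rewrite !poweRe1// lee_fin ltW.
Qed.

(** On ]0, 1] the weight exceeds 1 by at most e^a (1 + (Fs/r)^p), and the p-norm
bounds the integral by 2 e^a. Beyond 1 the rearrangement is at most its value
at 1, which the p-norm over [0, 1] bounds by r; there convexity of the
exponential bounds the excess by (e^a - 1) Fs/r, and the 1-norm bounds the
integral by e^a. *)
Lemma exp_weight_rearrangement_le :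
  (\int[lebesgue_measure]_(t in `]0%R, +oo[)
     (exp_weight a p (fine (Fs t) / r) - 1)%:E <= (3 * expR a)%:E)%E.
Proof.
pose G t := fine (Fs t).
have G0 t : 0 <= G t / r by rewrite divr_ge0 ?fine_ge0 ?(ltW r0).
have GE t : 0 < t -> Fs t = (G t)%:E.
  by move=> t0; rewrite fineK// ge0_fin_numE//; exact: rearrangement_lty.
have mG E : measurable_fun E (fun t => (exp_weight a p (G t / r) - 1)%:E).
  apply/measurable_EFinP; apply: measurable_funTS; apply: measurable_funB => //.
  apply: (measurableT_comp (measurable_exp_weight a p)).
  apply: measurable_funM => //.
  exact: (measurableT_comp (@fine_measurable R setT measurableT) (mFs (E := setT))).
have w0 t : (0 <= (exp_weight a p (G t / r) - 1)%:E)%E.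
  by rewrite lee_fin subr_ge0; apply: exp_weight_ge1 => //; exact: ltW.
have -> : `]0%R, +oo[%classic = `]0%R, 1%R] `|` `]1%R, +oo[ :> set R.
  by rewrite (@itv_bndbnd_setU _ _ _ (BRight 1)) ?bnd_simp//.
rewrite ge0_integral_setU//; last first.
- apply/disj_setPS => t [/=]; rewrite !in_itv/= andbT => /andP[_ t1].
  by rewrite ltNge t1.
- by move=> t _; exact: w0.
- exact: mG.
rewrite (_ : (3 * expR a)%:E = ((2 * expR a)%:E + (expR a)%:E)%E); last first.
  by rewrite -EFinD; congr EFin; ring.
apply: leeD.
- apply: (@le_trans _ _ (\int[lebesgue_measure]_(t in `]0%R, 1%R])
    ((expR a)%:E * (1%:E + (r^-1 `^ p)%:E * (Fs t `^ p))))%E).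
    apply: ge0_le_integral => //.
    + by move=> t _; exact: w0.
    + exact: mG.
    + apply: measurable_funeM; apply: emeasurable_funD => //.
      apply: measurable_funeM; exact: mFsp.
    + move=> t; rewrite /= in_itv/= => /andP[t0 _].
      rewrite GE// poweR_EFin -!EFinM lee_fin /=.
      rewrite -powRM ?invr_ge0 ?(ltW r0) ?fine_ge0//.
      rewrite (mulrC r^-1).
      exact: exp_weight_sub1_large (ltW p0) (G0 t).
  have Fsp0 t : (0 <= Fs t `^ p)%E by exact: poweR_ge0.
  have c0 : 0 <= r^-1 `^ p by exact: powR_ge0.
  have cFsp0 t : (0 <= (r^-1 `^ p)%:E * Fs t `^ p)%E by exact: mule_ge0.
  have mcFsp (E : set R) :
      measurable_fun E (fun t => (r^-1 `^ p)%:E * Fs t `^ p)%E.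
    by apply: measurable_funeM; exact: mFsp.
  rewrite ge0_integralZl_EFin//; last 2 first.
  + by move=> t _; exact: adde_ge0.
  + by apply: emeasurable_funD => //; exact: mcFsp.
  rewrite ge0_integralD//; last exact: mcFsp.
  rewrite integral_cst//= mul1e lebesgue_measure_itv/= lte_fin ltr01 sube0.
  rewrite ge0_integralZl_EFin//; last exact: mFsp.
  rewrite mulrC EFinM lee_pmul2l//; last by rewrite lte_fin expR_gt0.
  rewrite -[2%:E]/((1 + 1)%:E) EFinD leeD2l//.
  apply: (@le_trans _ _ ((r^-1 `^ p)%:E * (r `^ p)%:E)%E).
    rewrite lee_wpmul2l ?lee_fin ?powR_ge0//; apply: le_trans head_le.
    apply: ge0_subset_integral => //; first exact: mFsp.
    by apply: subset_itv => //; rewrite bnd_simp.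
  by rewrite -EFinM -powRM ?invr_ge0 ?(ltW r0)// mulVf ?gt_eqF// powR1.
- apply: (@le_trans _ _ (\int[lebesgue_measure]_(t in `]1%R, +oo[)
    (((expR a - 1) / r)%:E * Fs t))%E).
    apply: ge0_le_integral => //.
    + by move=> t _; exact: w0.
    + exact: mG.
    + by apply: measurable_funeM; exact: mFs.
    move=> t; rewrite /= in_itv/= andbT => t1.
    have t0 : 0 < t by apply: lt_trans t1; exact: ltr01.
    rewrite GE// -EFinM lee_fin -mulrA (mulrC r^-1).
    apply: exp_weight_sub1_small; rewrite G0/= ler_pdivrMr// mul1r.
    rewrite -lee_fin -GE//; apply: le_trans Fs1_le.
    by apply: rearrangement_nonincreasing; exact: ltW.
  have c0 : 0 <= (expR a - 1) / r.
    by rewrite divr_ge0 ?(ltW r0)// subr_ge0 -[leLHS]expR0 ler_expR.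
  rewrite ge0_integralZl_EFin//; last exact: mFs.
  apply: (@le_trans _ _ (((expR a - 1) / r)%:E * r%:E)%E).
    rewrite lee_wpmul2l ?lee_fin//; apply: le_trans tailE.
    rewrite Lnorm1 (@le_trans _ _ (\int[lebesgue_measure]_(t in `[1%R, +oo[) Fs t)%E)//.
      apply: ge0_subset_integral => //; first exact: mFs.
      by apply: subset_itv => //; rewrite bnd_simp.
    rewrite le_eqVlt; apply/orP; left; apply/eqP; rewrite [LHS]integral_mkcond.
    apply: eq_integral => t _; rewrite gee0_abs// patchE.
    by case: ifPn.
  by rewrite -EFinM divfK ?gt_eqF// lee_fin lerBlDr lerDl.
Qed.

End bound.

(** * Disjointifications *)

Lemma measurable_shift (R : realType) (c : R) :
  measurable_fun setT (fun t : R => t - c).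
Proof. by apply: measurable_funB. Qed.

(** Translation maps intervals to intervals of the same length, and Lebesgue
measure is determined by its values on intervals. *)
Lemma lebesgue_measure_shift (R : realType) (c : R) (A : set R) : measurable A ->
  lebesgue_measure ((fun t => t - c) @^-1` A) = lebesgue_measure A.
Proof.
move=> mA; apply/esym.
pose nu : {measure set (measurableTypeR R) -> \bar R} :=
  pushforward lebesgue_measure ((fun t => t - c) : _ -> measurableTypeR R).
change (lebesgue_measure A = nu (measurable_shift c) A).
apply: lebesgue_measure_unique => // _ [[a b]] _ <-.
rewrite /nu/= /pushforward.
have -> : (fun t => t - c) @^-1` `]a, b] = `]a + c, b + c]%classic.
  by apply/seteqP; split => x /=; rewrite !in_itv/= ltrBrDr lerBlDr.
rewrite !lebesgue_measure_itv/= !lte_fin ltrD2r; case: ifP => // _.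
by rewrite -!EFinD; congr EFin; ring.
Qed.

Lemma integral_shift (R : realType) (c : R) (u : R -> \bar R) :
  measurable_fun setT u -> (forall t, 0 <= u t)%E ->
  (\int[lebesgue_measure]_t u (t - c)%R = \int[lebesgue_measure]_t u t)%E.
Proof.
move=> mu u0.
have mshift : measurable_fun setT
    ((fun t => t - c) : measurableTypeR R -> measurableTypeR R).
  exact: measurable_shift.
transitivity (\int[pushforward lebesgue_measure
    ((fun t => t - c)%R : measurableTypeR R -> measurableTypeR R)]_t u t)%E.
  by rewrite (ge0_integral_pushforward mshift)//= preimage_setT.
by apply: eq_measure_integral => A mA _; exact: lebesgue_measure_shift.
Qed.

Lemma unit_interval_shift_inj (R : realType) (t : R) (i j : nat) :
  0 <= t - i%:R < 1 -> 0 <= t - j%:R < 1 -> i = j.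
Proof.
have H (k : nat) : 0 <= t - k%:R < 1 -> Num.truncn t = k.
  by move=> tk; apply: truncn_def; move: tk; rewrite -natr1; lra.
by move=> /H <- /H.
Qed.

(** The formula exhibits the disjointification as a sum of translates of functions
supported by [0, 1[. *)
Lemma disjointificationE (R : realType) (n : nat) (f : 'I_n -> R -> R) (t : R) :
  disjointification f t = \sum_(k < n) (f k \_ `[0, 1[) (t - k%:R).
Proof.
apply: eq_bigr => k _; rewrite patchE indicE.
have -> : (t \in `[k%:R, k%:R + 1[%classic) = (t - k%:R \in `[0, 1[%classic).
  by apply/idP/idP; rewrite !inE/= !in_itv/=; lra.
by case: ifP => _; rewrite ?mulr1 ?mulr0.
Qed.

(** At every point at most one of the translates is nonzero, so that applying a
function that vanishes at 0 commutes with the sum. *)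
Lemma disjointification_comp (R : realType) (n : nat) (f : 'I_n -> R -> R)
    (Psi : R -> R) (t : R) : Psi 0 = 0 ->
  Psi `|disjointification f t| =
  \sum_(k < n) ((fun x => Psi `|f k x|) \_ `[0, 1[) (t - k%:R).
Proof.
move=> Psi0; rewrite disjointificationE.
have [[k0 tk0]|no] := pselect (exists k : 'I_n, 0 <= t - k%:R < 1).
  have out (h : 'I_n -> R -> R) (k : 'I_n) : k != k0 -> (h k \_ `[0, 1[) (t - k%:R) = 0.
    move=> /eqP kk0; rewrite patchE memNset//= in_itv/= => tk; apply: kk0.
    by apply: val_inj; exact: unit_interval_shift_inj tk tk0.
  rewrite (bigD1 k0)//= [in RHS](bigD1 k0)//= !big1 ?addr0; last 2 first.
  - by move=> k; exact: (out (fun k x => Psi `|f k x|)).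
  - by move=> k; exact: out.
  by rewrite !patchE mem_set//= in_itv.
rewrite !big1 ?normr0//.
- by move=> k _; rewrite patchE memNset//= in_itv/= => tk; apply: no; exists k.
- by move=> k _; rewrite patchE memNset//= in_itv/= => tk; apply: no; exists k.
Qed.

Section disjointification_integral.
Variables (R : realType) (n : nat) (f : 'I_n -> R -> R).
Hypothesis mf : forall k, measurable_fun (`[0, 1]%classic : set R) (f k).

Let mf_half k : measurable_fun (`[0, 1[%classic : set R) (f k).
Proof.
apply: measurable_funS (mf k) => //.
by apply: subset_itv => //; rewrite bnd_simp.
Qed.

Lemma measurable_disjointification : measurable_fun setT (disjointification f).
Proof.
rewrite (_ : disjointification f =
    fun t => \sum_(k < n) (f k \_ `[0, 1[) (t - k%:R)); last first.
  by apply/funext => t; exact: disjointificationE.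
apply: measurable_sum => k; apply: (measurableT_comp _ (measurable_shift _)).
by apply/(measurable_restrictT _ (measurable_itv _)); exact: mf_half.
Qed.

Lemma tail_disjointification_fin :
  (tail_measure `]0%R, +oo[ (disjointification f) 0 < +oo)%E.
Proof.
apply: (@le_lt_trans _ _ (lebesgue_measure (`[0, n%:R]%classic : set R))).
  apply: le_measure; rewrite ?inE//.
    by apply: measurable_superlevel => //; apply: measurable_funTS;
       exact: measurable_disjointification.
  move=> t [/=]; rewrite in_itv/= andbT => t0 Ft; rewrite in_itv/= (ltW t0)/=.
  rewrite leNgt; apply/negP => nt; move: Ft.
  rewrite disjointificationE big1 ?normr0 ?ltxx// => k _.
  rewrite patchE memNset//= in_itv/= => /andP[_ tk].
  have : k.+1%:R <= n%:R :> R by rewrite ler_nat.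
  by rewrite -natr1; lra.
by rewrite lebesgue_measure_itv/= lte_fin; case: ifP => _; rewrite ?sube0 ?ltry.
Qed.

Lemma integral_disjointification (Psi : R -> R) :
  measurable_fun setT Psi -> Psi 0 = 0 -> (forall y, 0 <= y -> 0 <= Psi y) ->
  (\int[lebesgue_measure]_(t in `]0%R, +oo[) (Psi `|disjointification f t|)%:E =
   \sum_(k < n) \int[lebesgue_measure]_(x in `[0%R, 1%R]) (Psi `|f k x|)%:E)%E.
Proof.
move=> mPsi Psi0 Psi_ge0.
have mFPsi : measurable_fun setT (fun t => (Psi `|disjointification f t|)%:E).
  apply/measurable_EFinP; apply: (measurableT_comp mPsi).
  exact: (measurableT_comp (@normr_measurable R setT) measurable_disjointification).
rewrite integral_itv_obnd_cbnd; last exact: measurable_funTS.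
pose u k := (fun x => Psi `|f k x|) \_ `[0, 1[.
have mu k : measurable_fun setT (EFin \o u k).
  apply/measurable_EFinP; apply/(measurable_restrictT _ (measurable_itv _)).
  apply: (measurableT_comp mPsi).
  exact: (measurableT_comp (@normr_measurable R setT) (@mf_half k)).
have u0 k t : (0 <= (EFin \o u k) t)%E.
  by rewrite /= lee_fin /u patchE; case: ifP => // _; exact: Psi_ge0.
transitivity (\int[lebesgue_measure]_t \sum_(k < n) (EFin \o u k) (t - k%:R)%R)%E.
  rewrite integral_mkcond; apply: eq_integral => t _; rewrite patchE.
  rewrite /= sumEFin /u -disjointification_comp//.
  case: ifPn => //; rewrite notin_setE/= in_itv/= andbT => t0.
  rewrite disjointificationE big1 ?normr0 ?Psi0// => k _.
  rewrite patchE memNset//= in_itv/= => /andP[tk _]; apply: t0.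
  by move: tk; rewrite subr_ge0; exact: (le_trans (ler0n _ _)).
rewrite ge0_integral_sum//; last first.
  by move=> k; apply: (measurableT_comp (mu k) (measurable_shift _)).
apply: eq_bigr => k _; rewrite integral_shift//.
rewrite -integral_itv_bndo_bndc; last first.
  apply/measurable_EFinP/(measurableT_comp mPsi).
  exact: (measurableT_comp (@normr_measurable R setT) (@mf_half k)).
rewrite [RHS]integral_mkcond; apply: eq_integral => t _.
by rewrite /u /= !patchE; case: ifP.
Qed.

End disjointification_integral.

(** The case of [integral_disjointification] where Psi is the indicator of a ray:
the disjointification distributes like the f_k taken together. *)
Lemma tail_disjointification (R : realType) (n : nat) (f : 'I_n -> R -> R) (s : R) :
  (forall k, measurable_fun (`[0, 1]%classic : set R) (f k)) -> 0 <= s ->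
  tail_measure `]0, +oo[ (disjointification f) s =
  (\sum_(k < n) tail_measure `[0%R, 1%R] (f k) s)%E.
Proof.
move=> mf s0.
have mray : measurable (`]s, +oo[%classic : set R) by exact: measurable_itv.
have tail_int (D : set R) (h : R -> R) : measurable D -> measurable_fun D h ->
    tail_measure D h s =
    (\int[lebesgue_measure]_(x in D) (\1_(`]s, +oo[) `|h x|)%:E)%E.
  move=> mD mh; rewrite integral_mkcond.
  transitivity (\int[lebesgue_measure]_x (\1_(D `&` [set x | (s < `|h x|)%R]) x)%:E)%E.
    by rewrite integral_indic ?setIT//; exact: measurable_superlevel.
  apply: eq_integral => x _; rewrite patchE indicE in_setI.
  case: ifP => //= _; congr (_%:R%:E); congr nat_of_bool.
  by apply/idP/idP; rewrite !inE/= in_itv/= andbT.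
rewrite tail_int//; last by apply: measurable_funTS; exact: measurable_disjointification.
rewrite (@integral_disjointification _ _ _ mf (\1_(`]s, +oo[) : R -> R)).
- by apply: eq_bigr => k _; rewrite tail_int.
- exact: measurable_indic.
- by rewrite indicE memNset//= in_itv/= andbT; apply/negP; rewrite -leNgt.
- by move=> y _; rewrite indicE.
Qed.

(** * The upper bound *)

(** The bound 1 + t <= e^t, applied to finite terms: they are finite because they
are nonnegative with a finite sum. *)
Lemma prode_1D_le_expR (R : realType) (n : nat) (e : 'I_n -> \bar R) (c : R) :
  (forall k, 0 <= e k)%E -> (\sum_(k < n) e k <= c%:E)%E ->
  (\prod_(k < n) (1%:E + e k) <= (expR c)%:E)%E.
Proof.
move=> e0 ec.
have efin k : e k = (fine (e k))%:E.
  rewrite fineK//; have /sum_fin_numP : (\sum_(k < n) e k)%E \is a fin_num.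
    by rewrite ge0_fin_numE ?sume_ge0//; exact: le_lt_trans ec (ltry _).
  by apply; rewrite ?mem_index_enum.
have [x ex] : exists x : 'I_n -> R, e = EFin \o x.
  by exists (fine \o e); apply/funext => k; exact: efin.
move: e0 ec; rewrite {}ex {efin}/= => x0; rewrite sumEFin lee_fin => xc.
under eq_bigr do rewrite -EFinD.
rewrite prodEFin lee_fin.
apply: (@le_trans _ _ (\prod_(k < n) expR (x k))).
  apply: ler_prod => k _; rewrite expR_ge1Dx andbT addr_ge0//.
  by rewrite -lee_fin; exact: x0.
by rewrite -expR_sum ler_expR.
Qed.

Section upper.
Variables (R : realType) (p r : R) (n : nat) (f : 'I_n -> R -> R).
Hypothesis (p1 : 1 < p) (r0 : 0 < r).
Hypothesis mf : forall k, measurable_fun (`[0, 1]%classic : set R) (f k).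
Hypothesis indf : independent01 f.
Let Fs := decreasing_rearrangement `]0, +oo[ (disjointification f).
Hypothesis headE : ('N[lebesgue_measure]_(p%:E) [Fs \_ `[0%R, 1%R]] <= r%:E)%E.
Hypothesis tailE : ('N[lebesgue_measure]_1 [Fs \_ `[1%R, +oo[] <= r%:E)%E.

Let a := ln p.
Let phi (y : R) := exp_weight a p (`|y| / r).

Let p0 : 0 < p. Proof. exact: lt_trans p1. Qed.
Let a0 : 0 < a. Proof. by rewrite ln_gt0. Qed.

Let phi_ge1 y : 1 <= phi y.
Proof. by apply: exp_weight_ge1 (ltW a0) (ltW p0) _; rewrite divr_ge0// ltW. Qed.

Let mphi : measurable_fun setT phi.
Proof.
apply: (measurableT_comp (measurable_exp_weight a p)).
by apply: measurable_funM.
Qed.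

Let sum_excess_le :
  (\sum_(k < n) \int[lebesgue_measure]_(x in `[0%R, 1%R]) (phi (f k x) - 1)%:E <=
   (3 * p)%:E)%E.
Proof.
pose Psi y := exp_weight a p (y / r) - 1.
have mPsi : measurable_fun setT Psi.
  apply: measurable_funB => //; apply: (measurableT_comp (measurable_exp_weight a p)).
  exact: measurable_funM.
have Psi0 : Psi 0 = 0.
  rewrite /Psi /exp_weight mul0r (min_idPl _)// (max_idPr _)// mulr0 expR0.
  by rewrite powR1 mulr1 subrr.
have Psi_ge0 y : 0 <= y -> 0 <= Psi y.
  move=> y0; rewrite subr_ge0; apply: exp_weight_ge1 (ltW a0) (ltW p0) _.
  by rewrite divr_ge0// ltW.
have mF : measurable_fun (`]0, +oo[%classic : set R) (disjointification f).
  by apply: measurable_funTS; exact: measurable_disjointification.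
rewrite -(integral_disjointification mf mPsi Psi0 Psi_ge0).
rewrite (integral_rearrangement (measurable_itv _) mF
  (tail_disjointification_fin mf) mPsi Psi0);
  last by move=> y y0; apply: Psi_ge0; exact: ltW.
have := exp_weight_rearrangement_le (measurable_itv _) mF
  (tail_disjointification_fin mf) (ltW a0) p0 r0 headE tailE.
by rewrite [expR a]lnK.
Qed.

Let mphif k : measurable_fun (`[0, 1]%classic : set R) (fun x => phi (f k x)).
Proof. exact: (measurableT_comp mphi (@mf k)). Qed.

Let expectation_prod_phi_le :
  (\int[lebesgue_measure]_(x in `[0%R, 1%R]) (\prod_(k < n) phi (f k x))%:E <=
   (expR (3 * p))%:E)%E.
Proof.
have phi0 y : 0 <= phi y by apply: le_trans (phi_ge1 y).
have fin1 : (lebesgue_measure (`[0%R, 1%R]%classic : set R) < +oo)%E.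
  by rewrite lebesgue_measure_unit ltry.
have := @expectation_prod_le _ (measurableTypeR R) R lebesgue_measure _ n f phi
  (measurable_itv `[0, 1]) fin1 mf indf mphi phi0.
move=> /le_trans; apply.
have e0 k : (0 <= \int[lebesgue_measure]_(x in `[0%R, 1%R]) (phi (f k x) - 1)%:E)%E.
  by apply: integral_ge0 => x _; rewrite lee_fin subr_ge0.
apply: le_trans (prode_1D_le_expR e0 sum_excess_le).
rewrite le_eqVlt; apply/orP; left; apply/eqP; apply: eq_bigr => k _.
rewrite -(lebesgue_measure_unit R) -[X in (X + _)%E]mul1e -integral_cst//.
rewrite -ge0_integralD//; last 2 first.
- by move=> x _; rewrite lee_fin subr_ge0.
- apply/measurable_EFinP; apply: measurable_funB => //; exact: mphif.
by apply: eq_integral => x _; rewrite -EFinD addrC subrK.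
Qed.

(** The p-th power of the norm is at most (r p/a)^p times the expectation of the
product of the weights of |f_k| / r, which is at most e^(3p) when e^a = p. *)
Lemma Lnorm_sum_independent_le :
  ('N[lebesgue_measure]_(p%:E)
     [EFin \o ((fun x : R => (\sum_(k < n) f k x)%R) \_ `[0%R, 1%R])] <=
   (expR 3 * (p / ln p) * r)%:E)%E.
Proof.
pose S x := \sum_(k < n) f k x.
pose c := (r * (p / a)) `^ p.
have c0 : 0 <= c by exact: powR_ge0.
have pa0 : 0 < p / a by rewrite divr_gt0.
have mS : measurable_fun (`[0, 1]%classic : set R) S by exact: measurable_sum.
have Sp : (\int[lebesgue_measure]_(x in `[0%R, 1%R]) (`|S x| `^ p)%:E <=
    (c * expR (3 * p))%:E)%E.
  apply: (@le_trans _ _ (\int[lebesgue_measure]_(x in `[0%R, 1%R])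
      (c%:E * (\prod_(k < n) phi (f k x))%:E))%E).
    apply: ge0_le_integral => //.
    - apply/measurable_EFinP; apply: (measurableT_comp (measurable_powR p)).
      exact: (measurableT_comp (@normr_measurable R setT) mS).
    - apply/measurable_EFinP; apply: measurable_funM => //.
      apply: measurable_prod => k _; exact: mphif.
    - move=> x _; rewrite -EFinM lee_fin.
      have fr0 k : 0 <= `|f k x| / r by rewrite divr_ge0// ltW.
      have := powR_sum_le_prod_exp_weight a0 p0 fr0.
      move=> /(ler_wpM2l (powR_ge0 r p)); rewrite mulrA -(powRM p (ltW r0) (ltW pa0)).
      apply: le_trans; rewrite -(powRM p (ltW r0)) ?sumr_ge0//.
      apply: ge0_ler_powR; rewrite ?nnegrE ?(ltW p0)//.
        by apply: mulr_ge0; rewrite ?(ltW r0) ?sumr_ge0.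
      rewrite mulr_sumr; apply: le_trans (ler_norm_sum _ _ _) _.
      by apply: ler_sum => k _; rewrite mulrC divfK ?gt_eqF.
  rewrite ge0_integralZl_EFin//; last 2 first.
  - move=> x _; rewrite lee_fin; apply: prodr_ge0 => k _.
    exact: le_trans (phi_ge1 _).
  - by apply/measurable_EFinP; apply: measurable_prod => k _; exact: mphif.
  by rewrite EFinM lee_wpmul2l// lee_fin.
rewrite unlock/=.
have -> : (\int[lebesgue_measure]_x `|(((S \_ `[0%R, 1%R]) x)%:E : \bar R)| `^ p =
   \int[lebesgue_measure]_(x in `[0%R, 1%R]) (`|S x| `^ p)%:E)%E.
  rewrite [RHS]integral_mkcond; apply: eq_integral => x _.
  rewrite !patchE; case: ifP => _ //=.
  by rewrite normr0 powR0 ?gt_eqF.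
have pV0 : 0 <= p^-1 by rewrite invr_ge0 ltW.
apply: (le_trans (lee_poweR pV0 _ Sp)).
  by apply: integral_ge0 => x _; rewrite lee_fin powR_ge0.
rewrite poweR_EFin lee_fin powRM ?expR_ge0//.
rewrite -powRrM divff ?gt_eqF// powRr1;
  last by rewrite mulr_ge0 ?(ltW r0) ?(ltW pa0).
rewrite -expRM mulrC mulrK ?unitfE ?gt_eqF//.
by rewrite (mulrC r) mulrA.
Qed.

End upper.

(** * Independent digits *)

(** The two sets differ at most by the point 1. *)
Lemma measure_unit_closed (R : realType) (E : set R) :
  measurable (`[0, 1[%classic `&` E) ->
  measurable (`[0, 1]%classic `&` E) /\
  lebesgue_measure (`[0%R, 1%R] `&` E) = lebesgue_measure (`[0%R, 1%R[ `&` E).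
Proof.
move=> mE.
have split01 : `[0, 1]%classic `&` E = (`[0, 1[ `&` E) `|` ([set 1] `&` E).
  rewrite -setIUl; congr (_ `&` _); apply/seteqP; split => x /=; rewrite !in_itv/=.
    by move=> /andP[x0]; rewrite le_eqVlt => /predU1P[->|x1]; [right|left; rewrite x0].
  by case=> [/andP[x0 x1]|->]; [rewrite x0 ltW|rewrite ler01 lexx].
have m1 : measurable ([set 1] `&` E : set R).
  have [E1|E1] := pselect (E 1).
    by rewrite (setIidl _)// => _ ->.
  by rewrite (_ : _ `&` _ = set0)// -subset0 => x [->].
rewrite split01; split; first exact: measurableU.
have m0 : lebesgue_measure ([set 1] `&` E) = 0%E.
  apply/eqP; rewrite -measure_le0 -(lebesgue_measure_set1 (1 : R)).
  by apply: le_measure; rewrite ?inE//; exact: subIsetl.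
transitivity
    (lebesgue_measure (`[0%R, 1%R[ `&` E) + lebesgue_measure ([set 1%R] `&` E))%E.
  rewrite measureU// -subset0 => x [[/= x01 _] [/= x1 _]].
  by move: x01; rewrite x1 in_itv/= ltxx andbF.
by rewrite m0 adde0.
Qed.

Section cells.
Variables (R : realType) (T : finType) (t0 : T).

(** The elements of T label, in the order of their enumeration, the intervals of
the subdivision of [0, 1[ into #|T| equal parts; the default t0 is reached only
from x = 1 on. *)
Definition cell (x : R) : T := nth t0 (enum T) (Num.truncn (x * #|T|%:R)).

Let N : R := #|T|%:R.

Let N0 : 0 < N. Proof. by rewrite ltr0n; apply/card_gt0P; exists t0. Qed.

Lemma cellP (x : R) (t : T) : 0 <= x < 1 ->
  (cell x == t) = ((enum_rank t)%:R / N <= x < (enum_rank t).+1%:R / N).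
Proof.
move=> /andP[x0 x1]; rewrite ler_pdivrMr// ltr_pdivlMr// -truncn_eq; last first.
  by rewrite mulr_ge0// ltW.
have xN : (Num.truncn (x * N) < #|T|)%N.
  by rewrite truncn_lt_nat ?mulr_ge0 ?(ltW N0)// gtr_pMl.
have sT : size (enum T) = #|T| by rewrite -cardE.
by rewrite /cell -{1}(nth_enum_rank t0 t) nth_uniq ?enum_uniq ?sT.
Qed.

(** The cell of a uniformly distributed point is uniformly distributed on T, so
that probabilities become cardinals. *)
Lemma measure_cell (P : pred T) :
  measurable (`[0, 1]%classic `&` [set x : R | P (cell x)]) /\
  lebesgue_measure (`[0%R, 1%R] `&` [set x : R | P (cell x)]) =
    (#|P|%:R / N)%:E.
Proof.
pose B (t : T) : set R := `[(enum_rank t)%:R / N, (enum_rank t).+1%:R / N[%classic.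
have B01 t x : B t x -> 0 <= x < 1.
  rewrite /B/= in_itv/= => /andP[tx xt]; apply/andP; split.
    by apply: le_trans tx; rewrite divr_ge0// ltW.
  by apply: lt_le_trans xt _; rewrite ler_pdivrMr// mul1r ler_nat.
have BE x t : 0 <= x < 1 -> B t x <-> cell x = t.
  by move=> x01; rewrite /B/= in_itv/= -cellP//; split => [/eqP|->].
have mB t : measurable (B t) by exact: measurable_itv.
pose F (k : 'I_#|P|) := B (enum_val k).
have E : `[0, 1[%classic `&` [set x | P (cell x)] = \big[setU/set0]_(k < #|P|) F k.
  rewrite -bigcup_seq; apply/seteqP; split => x /=.
    rewrite in_itv/= => -[x01 Px]; exists (enum_rank_in Px (cell x)) => /=.
      by rewrite mem_index_enum.
    by rewrite /F enum_rankK_in//; exact/BE.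
  move=> [k _]; rewrite /F => Bx; have x01 := B01 _ _ Bx.
  rewrite in_itv/=; split => //; move/(BE _ _ x01): Bx => ->.
  exact: enum_valP.
have tF : trivIset setT F.
  move=> i j _ _ [x [Bi Bj]]; have x01 := B01 _ _ Bi; apply: enum_val_inj.
  by move/(BE _ _ x01): Bi => <-; move/(BE _ _ x01): Bj => <-.
have mU : measurable (\big[setU/set0]_(k < #|P|) F k).
  by apply: bigsetU_measurable => k _; exact: mB.
have [|mE ->] := @measure_unit_closed R [set x | P (cell x)]; first by rewrite E.
split => //; rewrite E measure_semi_additive_ord//=; last by move=> k; exact: mB.
have BN t : lebesgue_measure (B t) = (N^-1)%:E.
  rewrite lebesgue_measure_itv/= lte_fin ltr_pM2r ?invr_gt0// ltr_nat ltnSn.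
  by rewrite -EFinD -natr1; congr EFin; ring.
under eq_bigr do rewrite /F BN.
by rewrite sumEFin sumr_const card_ord mulr_natl.
Qed.

End cells.

Lemma card_forall_ffun (I J : finType) (Q : I -> pred J) :
  #|[pred g : {ffun I -> J} | [forall k, Q k (g k)]]| = (\prod_k #|Q k|)%N.
Proof.
transitivity #|(family (fun k : I => [pred j | Q k j]) : simpl_pred {ffun I -> J})|.
  by apply: eq_card => g; rewrite !inE.
by rewrite card_family foldrE big_image.
Qed.

Section digits.
Variables (R : realType) (m : nat).
Local Notation n := m.+1.
Let T : finType := {ffun 'I_n -> 'I_n}.
Let t0 : T := [ffun=> ord0].

(** Coding the n^n intervals by the functions from 'I_n to itself produces n
independent uniform digits in base n. *)
Definition zero_digit (k : 'I_n) (x : R) : R := (cell t0 x k == ord0)%:R.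

Let cardT : #|T| = (n ^ n)%N. Proof. by rewrite card_ffun card_ord. Qed.

Let measure_digit (k : 'I_n) (Q : pred 'I_n) :
  measurable (`[0, 1]%classic `&` [set x : R | Q (cell t0 x k)]) /\
  lebesgue_measure (`[0%R, 1%R] `&` [set x : R | Q (cell t0 x k)]) =
    (#|Q|%:R / n%:R)%:E.
Proof.
have [mQ ->] := @measure_cell R T t0 [pred g : T | Q (g k)]; split=> //.
pose Q' (j : 'I_n) : pred 'I_n := if j == k then Q else predT.
have -> : #|[pred g : T | Q (g k)]| = (#|Q| * n ^ m)%N.
  transitivity #|[pred g : T | [forall j, Q' j (g j)]]|.
    apply: eq_card => g; rewrite !inE; apply/idP/forallP => [Qg j|/(_ k)].
      by rewrite /Q'; case: eqP => // ->.
    by rewrite /Q' eqxx.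
  rewrite card_forall_ffun (bigD1 k)//= /Q' eqxx; congr muln.
  rewrite (eq_bigr (fun=> n)) => [|j /negPf->]; last by rewrite card_ord.
  by rewrite prod_nat_const cardC1 card_ord.
congr EFin; rewrite cardT expnSr !natrM.
by rewrite (mulrC #|Q|%:R) -mulf_div divff ?mul1r// pnatr_eq0 expn_eq0.
Qed.

(** Probabilities are counts of functions divided by n^n, and the number of
functions whose value at each index is restricted is the product of the numbers
of allowed values. *)
Lemma independent_zero_digit : independent01 zero_digit.
Proof.
move=> A mA.
pose Q k : pred 'I_n := fun j => `[< A k ((j == ord0)%:R) >].
have digitE k : zero_digit k @^-1` A k = [set x | Q k (cell t0 x k)].
  by apply/seteqP; split => x /= /asboolP.
under eq_bigr do rewrite digitE (measure_digit _ _).2.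
rewrite (_ : \bigcap_k _ = [set x | [forall k, Q k (cell t0 x k)]]); last first.
  apply/seteqP; split => x /=.
    by move=> Ax; apply/forallP => k; apply/asboolP; exact: Ax.
  by move=> /forallP Qx k _; apply/asboolP; exact: Qx.
rewrite (@measure_cell R T t0 [pred g : T | [forall k, Q k (g k)]]).2.
rewrite card_forall_ffun prodEFin cardT prodf_div prodr_const card_ord.
by rewrite natr_prod natrX.
Qed.

Let zeroQ : pred 'I_n := fun j => j == ord0.

Let digit_set k : set R := `[0, 1] `&` [set x | zeroQ (cell t0 x k)].

Let card_zeroQ : #|zeroQ| = 1%N.
Proof. by rewrite -(card1 (ord0 : 'I_n)); apply: eq_card. Qed.

Lemma restrict_zero_digit k : zero_digit k \_ `[0, 1] = \1_(digit_set k).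
Proof.
apply/funext => x; rewrite patchE indicE in_setI /zero_digit.
by case: ifP => //= _; congr (_%:R); congr nat_of_bool; apply/idP/idP; rewrite inE.
Qed.

Lemma measurable_zero_digit k : measurable_fun (`[0, 1]%classic : set R) (zero_digit k).
Proof.
apply/(measurable_restrictT _ (measurable_itv _)); rewrite restrict_zero_digit.
by apply: measurable_indic; exact: (measure_digit k zeroQ).1.
Qed.

Lemma Lp01_zero_digit (p : R) k : 0 < p -> Lp01 p (zero_digit k).
Proof.
move=> p0; rewrite /Lp01 restrict_zero_digit.
have mE : measurable (digit_set k) by exact: (measure_digit k zeroQ).1.
rewrite inE; apply/andP; split; rewrite inE/=.
  exact: measurable_indic.
rewrite /finite_norm unlock/= poweR_lty//.
rewrite (_ : (\int[_]_x _)%E = lebesgue_measure (digit_set k)).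
  by rewrite (measure_digit k zeroQ).2 ltry.
transitivity (\int[lebesgue_measure]_x (\1_(digit_set k) x)%:E)%E.
  apply: eq_integral => x _; rewrite indicE; case: (x \in _) => /=.
    by rewrite normr1 powR1.
  by rewrite normr0 powR0 ?gt_eqF.
by rewrite integral_indic ?setIT.
Qed.

(** The n events have probability 1/n each, so the disjointification is the
indicator of a set of measure 1. *)
Lemma tail_zero_digit (s : R) : 0 <= s ->
  tail_measure `]0, +oo[ (disjointification zero_digit) s =
  (if s < 1 then 1 else 0)%:E.
Proof.
move=> s0; rewrite tail_disjointification//; last exact: measurable_zero_digit.
have tE k : tail_measure `[0%R, 1%R] (zero_digit k) s =
      ((if s < 1 then 1 else 0) / n%:R)%:E.
  rewrite /tail_measure /zero_digit.
  case: ltP => s1; last first.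
    rewrite (_ : _ `&` _ = set0) ?measure0 ?mul0r//.
    rewrite -subset0 => x [_ /=]; rewrite ger0_norm ?ler0n//.
    by rewrite ltNge (le_trans _ s1)// lern1 leq_b1.
  have := (measure_digit k zeroQ).2; rewrite card_zeroQ => <-.
  congr (lebesgue_measure (_ `&` _)).
  apply/seteqP; split => x /=; rewrite ger0_norm ?ler0n// /zeroQ.
    by case: eqP => //= _; rewrite ltNge s0.
  by move=> ->.
under eq_bigr do rewrite tE.
rewrite sumEFin sumr_const card_ord; congr EFin.
by rewrite -[LHS]mulr_natr divfK ?pnatr_eq0.
Qed.

End digits.

(** * The lower bound *)

Section lower.
Variables (R : realType) (m : nat) (p : R).
Local Notation n := m.+1.
Hypothesis p0 : 0 < p.
Let F := disjointification (@zero_digit R m).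
Let Fs := decreasing_rearrangement `]0, +oo[ F.

Let Fs_head (t : R) : 0 <= t -> (Fs t <= 1%:E)%E.
Proof.
move=> t0; apply: rearrangement_le; rewrite ?ler01//.
by rewrite tail_zero_digit ?ler01// ltxx lee_fin.
Qed.

Let Fs_tail (t : R) : 1 <= t -> Fs t = 0%:E.
Proof.
move=> t1; apply/eqP; rewrite eq_le rearrangement_ge0 andbT.
by apply: rearrangement_le => //; rewrite tail_zero_digit// ltr01 lee_fin.
Qed.

Lemma Lnorm_head_zero_digit :
  ('N[lebesgue_measure]_(p%:E) [Fs \_ `[0%R, 1%R]] <= 1%:E)%E.
Proof.
rewrite unlock/= -[leRHS](poweR1r p^-1).
have pV0 : 0 <= p^-1 by rewrite invr_ge0 ltW.
apply: lee_poweR => //; first by apply: integral_ge0 => t _; exact: poweR_ge0.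
have <- : (\int[lebesgue_measure]_t (\1_(`[0%R, 1%R]%classic : set R) t)%:E)%E = 1%:E.
  rewrite integral_indic//.
  rewrite setIT; exact: lebesgue_measure_unit.
apply: ge0_le_integral => //.
- by move=> t _; exact: poweR_ge0.
- apply: (measurableT_comp (measurable_poweR p)).
  apply: measurableT_comp => //.
  apply/(measurable_restrictT _ (measurable_itv _)); apply: measurable_funTS.
  apply: measurable_rearrangement => //; apply: measurable_funTS.
  by apply: measurable_disjointification; exact: measurable_zero_digit.
- by apply/measurable_EFinP; exact: measurable_indic.
- move=> t _; rewrite patchE indicE; case: ifPn => [|_]; last first.
    by rewrite abse0 poweR0r ?gt_eqF.
  rewrite inE/= in_itv/= => /andP[t0 _]; rewrite -(poweR1r p).
  rewrite gee0_abs ?rearrangement_ge0//.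
  by apply: lee_poweR; rewrite ?(ltW p0) ?rearrangement_ge0 ?Fs_head.
Qed.

Lemma Lnorm_tail_zero_digit :
  ('N[lebesgue_measure]_1 [Fs \_ `[1%R, +oo[] = 0)%E.
Proof.
rewrite (_ : Fs \_ _ = cst 0%E) ?Lnorm0//.
apply/funext => t; rewrite patchE; case: ifPn => //.
by rewrite inE/= in_itv/= andbT => /Fs_tail.
Qed.

(** All the digits vanish with probability n^(-n), and then the sum is n. *)
Lemma Lnorm_sum_zero_digit_ge :
  ((n%:R * (n ^ n)%:R^-1 `^ p^-1)%:E <= 'N[lebesgue_measure]_(p%:E)
     [EFin \o ((fun x : R => (\sum_(k < n) zero_digit k x)%R) \_ `[0%R, 1%R])])%E.
Proof.
pose T : finType := {ffun 'I_n -> 'I_n}; pose t0 : T := [ffun=> ord0].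
pose P : pred T := fun g => [forall k : 'I_n, g k == ord0].
pose E : set R := `[0, 1] `&` [set x | P (cell t0 x)].
have [mE muE] := @measure_cell R T t0 P.
rewrite -/E in mE; have {}muE : lebesgue_measure E = ((n ^ n)%:R^-1)%:E :> \bar R.
  rewrite muE; have -> : #|P| = 1%N.
    rewrite -(card1 t0); apply: eq_card => g; rewrite !inE; apply/forallP/eqP.
      by move=> g0; apply/ffunP => k; rewrite ffunE; exact/eqP.
    by move=> -> k; rewrite ffunE.
  by rewrite card_ffun card_ord mul1r.
pose S x := \sum_(k < n) zero_digit k x : R.
have mS : measurable_fun setT (S \_ `[0, 1]).
  apply/(measurable_restrictT _ (measurable_itv _)).
  by apply: measurable_sum => k; exact: measurable_zero_digit.
have n0 : 0 <= n%:R :> R by exact: ler0n.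
have N0 : 0 <= (n ^ n)%:R^-1 :> R by rewrite invr_ge0 ler0n.
rewrite unlock/=.
have pV0 : 0 <= p^-1 by rewrite invr_ge0 ltW.
have -> : n%:R * (n ^ n)%:R^-1 `^ p^-1 = (n%:R `^ p * (n ^ n)%:R^-1) `^ p^-1 :> R.
  rewrite powRM ?powR_ge0// -powRrM divff ?gt_eqF// powRr1//.
rewrite -poweR_EFin; apply: lee_poweR pV0 _ _.
  by rewrite lee_fin mulr_ge0 ?powR_ge0.
rewrite EFinM -muE -[E]setIT -integral_indic//.
rewrite -ge0_integralZl_EFin ?powR_ge0//; last first.
  by apply/measurable_EFinP; exact: measurable_indic.
apply: ge0_le_integral => //.
- by apply: measurable_funeM; apply/measurable_EFinP; exact: measurable_indic.
- apply/measurable_EFinP; apply: (measurableT_comp (measurable_powR p)).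
  exact: (measurableT_comp (@normr_measurable R setT) mS).
- move=> x _; rewrite indicE; have [Ex|] := boolP (x \in E); last first.
    by rewrite mule0 lee_fin powR_ge0.
  rewrite mule1; move: Ex; rewrite inE => -[x01 /forallP Px].
  rewrite patchE mem_set//= /zero_digit (eq_bigr (fun=> 1)); last first.
    by move=> k _; rewrite Px.
  by rewrite sumr_const card_ord ger0_norm// ler0n.
Qed.

(** For the digits the two norms of the rearrangement add up to at most 1, so a
nonnegative C is at least the norm of the sum. A negative C would make the
right-hand side nonpositive, whereas the norm of the sum is positive. *)
Lemma rosenthal_admissible_ge (C : R) : rosenthal_admissible p C ->
  n%:R * (n ^ n)%:R^-1 `^ p^-1 <= C.
Proof.
move=> adm.
have : (_ <= C%:E * ('N[lebesgue_measure]_(p%:E) [Fs \_ `[0%R, 1%R]] +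
    'N[lebesgue_measure]_1 [Fs \_ `[1%R, +oo[]))%E :=
  adm n (@zero_digit R m) (fun k => Lp01_zero_digit k p0)
    (@independent_zero_digit R m).
rewrite Lnorm_tail_zero_digit adde0 => /(le_trans Lnorm_sum_zero_digit_ge).
set L := n%:R * _.
set X := ('N[lebesgue_measure]_(p%:E) [Fs \_ `[0%R, 1%R]])%E => LCX.
have L0 : 0 < L.
  by rewrite mulr_gt0 ?ltr0n// powR_gt0// invr_gt0 ltr0n expn_gt0.
have X0 : (0 <= X)%E by exact: Lnorm_ge0.
have X1 : (X <= 1%:E)%E by exact: Lnorm_head_zero_digit.
rewrite -lee_fin.
have [C0|C0] := leP 0 C.
  by apply: le_trans LCX _; rewrite -[leRHS]mule1 lee_wpmul2l// lee_fin.
have : (L%:E <= 0)%E.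
  by apply: le_trans LCX _; rewrite mule_le0_ge0// lee_fin ltW.
by rewrite leNgt lte_fin L0.
Qed.

End lower.

(** * The least constant *)

(** Enlarging C and y is needed twice: for the upper bound, where the norms of the
rearrangement are to be bounded by a positive number, and for the infimum of
the admissible constants, which is only approached. For infinite y the
positivity of C makes the right-hand side infinite. *)
Lemma le_mule_of_gt (R : realType) (C : R) (x y : \bar R) : 0 < C -> (0 <= y)%E ->
  (forall e, 0 < e -> y \is a fin_num -> (x <= (C + e)%:E * (y + e%:E))%E) ->
  (x <= C%:E * y)%E.
Proof.
move=> C0; case: y => [y||]// y0 H; last by rewrite gt0_muley ?lte_fin// leey.
rewrite lee_fin in y0.
apply/lee_addgt0Pr => e e0.
pose M := C + y + 1.
have M0 : 0 < M by rewrite /M; lra.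
(* With d <= 1 and d (C + y + 1) <= e, the excess C d + d y + d d is at most e. *)
pose d := Num.min 1 (e / M).
have d0 : 0 < d by rewrite lt_min ltr01 divr_gt0.
have d1 : d <= 1 by rewrite ge_min lexx.
have dM : d * M <= e by rewrite -ler_pdivlMr// ge_min lexx orbT.
apply: le_trans (H d d0 isT) _.
rewrite -EFinD -!EFinM -EFinD lee_fin.
have : d * d <= d by rewrite ger_pMl.
move: dM; rewrite /M; nra.
Qed.

Lemma Lp01_measurable (R : realType) (p : R) (f : R -> R) :
  Lp01 p f -> measurable_fun (`[0, 1]%classic : set R) f.
Proof.
rewrite /Lp01 => /sub_Lfun_mfun; rewrite inE => mf.
exact/(measurable_restrictT _ (measurable_itv _)).
Qed.

Lemma rosenthal_admissible_upper (R : realType) (p : R) : 1 < p ->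
  rosenthal_admissible p (expR 3 * (p / ln p)).
Proof.
move=> p1 n f Lf indf; cbv zeta; set Fstar := decreasing_rearrangement _ _.
have mf k := Lp01_measurable (Lf k).
have p0 : 0 < p := lt_trans ltr01 p1.
have C0 : 0 < expR 3 * (p / ln p) :> R by rewrite mulr_gt0 ?expR_gt0// divr_gt0// ln_gt0.
apply: le_mule_of_gt => //; first by rewrite adde_ge0// Lnorm_ge0.
set A := ('N[lebesgue_measure]_(p%:E) [Fstar \_ `[0%R, 1%R]])%E.
set B := ('N[lebesgue_measure]_1 [Fstar \_ `[1%R, +oo[])%E.
have A0 : (0 <= A)%E by exact: Lnorm_ge0.
have B0 : (0 <= B)%E by exact: Lnorm_ge0.
move=> e e0 ABfin; pose r := fine (A + B) + e.
have rE : (A + B + e%:E = r%:E)%E by rewrite EFinD fineK.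
have r0 : 0 < r by rewrite ltr_wpDl// fine_ge0// adde_ge0.
have Ar : (A <= r%:E)%E by rewrite -rE -addeA leeDl// adde_ge0// lee_fin ltW.
have Br : (B <= r%:E)%E.
  by rewrite -rE addeAC leeDr// adde_ge0// lee_fin ltW.
apply: le_trans (Lnorm_sum_independent_le p1 r0 mf indf Ar Br) _.
by rewrite rE -EFinM lee_fin ler_wpM2r ?(ltW r0)// lerDl ltW.
Qed.

(** The infimum of the admissible constants is admissible: each instance of the
inequality passes to the limit, including those with an infinite right-hand
side because the infimum is positive. *)
Lemma rosenthal_constant_exists (R : realType) (p L U : R) : 0 < L ->
  (forall C, rosenthal_admissible p C -> L <= C) -> rosenthal_admissible p U ->
  exists C, [/\ is_rosenthal_constant p C, L <= C & C <= U].
Proof.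
move=> L0 lb admU.
pose S := [set C : R | rosenthal_admissible p C].
have infS : has_inf S by split; [exists U|exists L].
have LS : L <= inf S by apply: lb_le_inf; [exists U|].
exists (inf S); split => //; last by apply: ge_inf => //; exists L.
split; last by move=> C' admC'; apply: ge_inf => //; exists L.
move=> n f Lf indf; cbv zeta; set Fstar := decreasing_rearrangement _ _.
have C0 : 0 < inf S := lt_le_trans L0 LS.
apply: le_mule_of_gt => //; first by rewrite adde_ge0// Lnorm_ge0.
move=> e e0 _; have [C admC Ce] := inf_adherent e0 infS.
apply: le_trans (admC n f Lf indf) _.
have C_ge0 : 0 <= C by apply: le_trans (ltW L0) (lb _ admC).
apply: lee_pmul; rewrite ?lee_fin ?adde_ge0 ?Lnorm_ge0 ?(ltW Ce)//.
by rewrite leeDl// lee_fin ltW.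
Qed.

Lemma le_ln_self (R : realType) (x : R) : 0 < x -> 1 + ln x <= x.
Proof. by move=> x0; apply: le_trans (expR_ge1Dx _) _; rewrite lnK. Qed.

(** As n <= p / ln p <= p, one has n ln n <= n ln p <= p. *)
Lemma self_power_root_ge (R : realType) (p : R) (n : nat) : expR 1 <= p ->
  (0 < n)%N -> n%:R <= p / ln p ->
  expR (-1) <= (n ^ n)%:R^-1 `^ p^-1.
Proof.
move=> pe n0 nq.
have p0 : 0 < p := lt_le_trans (expR_gt0 1) pe.
have lnp1 : 1 <= ln p by rewrite -[leLHS]expRK ler_ln ?posrE ?expR_gt0.
have lnp0 : 0 < ln p by lra.
have np : n%:R <= p by apply: le_trans nq _; rewrite ler_pdivrMr// ler_peMr// ltW.
have nR0 : 0 < n%:R :> R by rewrite ltr0n.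
have N0 : 0 < (n ^ n)%:R :> R by rewrite ltr0n expn_gt0 n0.
rewrite /powR gt_eqF ?invr_gt0// ler_expR lnV ?posrE// natrX lnXn//.
rewrite mulrN lerN2 mulrC ler_pdivrMr// mul1r -[leLHS]mulr_natl.
have lnn : ln n%:R <= ln p by rewrite ler_ln ?posrE.
have nlnp : n%:R * ln p <= p by rewrite -ler_pdivlMr.
by apply: le_trans nlnp; rewrite ler_wpM2l// ltW.
Qed.

(** Take n to be the integer part of p / ln p in [rosenthal_admissible_ge]; it is
at least half of p / ln p, which is at least 1. *)
Lemma rosenthal_admissible_lower (R : realType) (p C : R) : expR 1 <= p ->
  rosenthal_admissible p C -> expR (-1) / 2 * (p / ln p) <= C.
Proof.
move=> pe adm.
have p0 : 0 < p := lt_le_trans (expR_gt0 1) pe.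
have lnp1 : 1 <= ln p by rewrite -[leLHS]expRK ler_ln ?posrE ?expR_gt0.
have lnp0 : 0 < ln p by lra.
pose q := p / ln p; have q0 : 0 < q by rewrite divr_gt0.
have q1 : 1 <= q by rewrite ler_pdivlMr// mul1r; have := le_ln_self p0; lra.
pose n := Num.truncn q.
have n0 : (0 < n)%N by rewrite truncn_gt0.
have nq : n%:R <= q by rewrite truncn_le ltW.
have qn : q <= 2 * n%:R.
  have : q < n.+1%:R := truncnS_gt q.
  have : 1 <= n%:R :> R by rewrite ler1n.
  by rewrite -natr1; lra.
have := @rosenthal_admissible_ge R n.-1 p p0 C adm; rewrite prednK//.
apply: le_trans; apply: (@le_trans _ _ (n%:R * expR (-1))).
  by rewrite -/q; have := expR_gt0 (-1 : R); nra.
by rewrite ler_wpM2l// self_power_root_ge.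
Qed.

Theorem corollary8 (R : realType) :
  exists c alpha : R, [/\ 0 < c, c <= alpha &
    \forall p \near +oo,
      exists C : R, [/\ is_rosenthal_constant p C,
        c * (p / ln (p + 1)) <= C &
        C <= alpha * (p / ln (p + 1))]].
Proof.
exists (expR (-1) / 2), (2 * expR 3); split.
- by rewrite divr_gt0 ?expR_gt0.
- have : expR (-1) <= expR 3 :> R by rewrite ler_expR; lra.
  by have := expR_gt0 (-1 : R); lra.
near=> p.
have pe : expR 1 <= p by near: p; apply: nbhs_pinfty_ge; rewrite num_real.
have p2 : 2 <= p by have := expR_ge1Dx (1 : R); lra.
have p0 : 0 < p by lra.
have lnp0 : 0 < ln p by rewrite ln_gt0//; lra.
have lnp10 : 0 < ln (p + 1) by rewrite ln_gt0//; lra.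
have lnle : ln p <= ln (p + 1) by rewrite ler_ln ?posrE; lra.
(* p + 1 <= p^2 for p >= 2; this exchanges ln p and ln (p + 1). *)
have ln2 : ln (p + 1) <= 2 * ln p.
  rewrite mulr_natl -lnXn// ler_ln ?posrE ?exprn_gt0//; last by lra.
  by rewrite expr2; nra.
have p1 : 1 < p by lra.
have e0 : 0 < expR (-1) / 2 * (p / ln p) :> R by rewrite mulr_gt0 ?divr_gt0 ?expR_gt0.
have [C [CR LC CU]] := rosenthal_constant_exists e0
  (fun C => @rosenthal_admissible_lower R p C pe) (rosenthal_admissible_upper p1).
exists C; split => //.
- apply: le_trans LC; rewrite ler_wpM2l ?divr_ge0 ?expR_ge0//.
  by rewrite ler_wpM2l ?(ltW p0)// lef_pV2 ?posrE.
- have h : p / ln p <= 2 * (p / ln (p + 1)).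
    by rewrite ler_pdivrMr// mulrA mulrAC ler_pdivlMr//; nra.
  apply: le_trans CU (le_trans (ler_wpM2l (expR_ge0 3) h) _).
  rewrite le_eqVlt; apply/orP; left; apply/eqP; ring.
Unshelve. all: by end_near.
Qed.
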